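(* Let $G$ be a group with neutral element $e$ and let $A=\bigoplus_{g\in G}A_g$ be a finite dimensional $G$-graded algebra over a field $k$. Let $(-)_e:A-gr\to A_e-mod$ be the functor taking a graded module to its homogeneous component of degree $e$. The following assertions are true. (1) If $A$ is graded Frobenius and $A$ is a projective left $A_e$-module, then $(-)_e$ is a Frobenius functor. (2) If $(-)_e$ is a Frobenius functor and $A_e$ is a Frobenius algebra, then $A$ is graded Frobenius.
   Context: $A-gr$ denotes the category of $G$-graded left $A$-modules (with degree-preserving $A$-linear maps), and $A_e-mod$ the category of left $A_e$-modules. A functor $F:\mathcal{A}\to\mathcal{B}$ is called Frobenius if it is both a left and a right adjoint of one and the same functor $\mathcal{B}\to\mathcal{A}$. A finite dimensional $k$-algebra $R$ is Frobenius if $R\simeq R^*$ as left $R$-modules, where $R^*=\mathrm{Hom}_k(R,k)$ with $(af)(x)=f(xa)$. The dual space $A^*$ is a graded left $A$-module with $(af)(x)=f(xa)$ and grading $(A^* )_g=\{f\in A^* \mid f(A_h)=0 \text{ for any } h\neq g^{-1}\}$. $A$ is called graded Frobenius if $A\simeq A^*$ in $A-gr$. *)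

(* Defs.v *)
From HB Require Import structures.
From mathcomp Require Import all_boot all_algebra falgebra.
From mathcomp Require Import boolp.

Set Implicit Arguments.
Unset Strict Implicit.
Unset Printing Implicit Defensive.

Import GRing.Theory.
Local Open Scope ring_scope.

Record category := Category {
  obj :> Type;
  hom : obj -> obj -> Type;
  idm : forall X, hom X X;
  catcomp : forall X Y Z, hom Y Z -> hom X Y -> hom X Z;
  compA : forall X Y Z W (f : hom Z W) (g : hom Y Z) (h : hom X Y),
    catcomp f (catcomp g h) = catcomp (catcomp f g) h;
  comp1m : forall X Y (f : hom X Y), catcomp (idm Y) f = f;
  compm1 : forall X Y (f : hom X Y), catcomp f (idm X) = f }.

Arguments idm {c} X.
Arguments catcomp {c X Y Z}.

Definition isomorphic (C : category) (X Y : C) : Prop :=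
  exists (f : hom X Y) (g : hom Y X), catcomp g f = idm X /\ catcomp f g = idm Y.

Record functor (C D : category) := Functor {
  fobj :> C -> D;
  fmap : forall X Y : C, hom X Y -> hom (fobj X) (fobj Y);
  fmap1 : forall X : C, fmap (idm X) = idm (fobj X);
  fmapM : forall (X Y Z : C) (f : hom Y Z) (g : hom X Y),
    fmap (catcomp f g) = catcomp (fmap f) (fmap g) }.

Arguments fmap {C D} _ {X Y}.

Definition left_adjoint (C D : category) (L : functor C D) (R : functor D C) :
    Prop :=
  exists phi : forall (X : C) (Y : D), hom (L X) Y -> hom X (R Y),
    (forall X Y, bijective (@phi X Y)) /\
    (forall (X X' : C) (Y Y' : D) (a : hom X' X) (b : hom Y Y')
            (f : hom (L X) Y),
      phi X' Y' (catcomp b (catcomp f (fmap L a)))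
        = catcomp (fmap R b) (catcomp (phi X Y f) a)).

Definition frobenius_functor (C D : category) (F : functor C D) : Prop :=
  exists H : functor D C, left_adjoint F H /\ left_adjoint H F.

Lemma linear_eq (R : pzRingType) (M N : lmodType R) (f g : {linear M -> N}) :
  f =1 g -> f = g.
Proof.
case: f g => [f [[f1] [f2]]] [g [[g1] [g2]]] /= /funext fg.
rewrite -/(f = g) in fg.
move: f1 f2 g1 g2; rewrite fg => f1 f2 g1 g2.
by rewrite (Prop_irrelevance f1 g1) (Prop_irrelevance f2 g2).
Qed.

Section ModCategory.
Variable R : pzRingType.

Definition mod_id (M : lmodType R) : {linear M -> M} := idfun.
Definition mod_comp (M N P : lmodType R) (f : {linear N -> P})
  (g : {linear M -> N}) : {linear M -> P} := f \o g.

Definition mod_cat : category.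
Proof.
refine (@Category (lmodType R) (fun M N => {linear M -> N}) mod_id mod_comp
  _ _ _) => *; exact: linear_eq.
Defined.

Definition projective (P : lmodType R) : Prop :=
  forall (M N : lmodType R) (p : {linear M -> N}) (f : {linear P -> N}),
    (forall y, exists x, p x = y) ->
    exists g : {linear P -> M}, forall x, p (g x) = f x.

End ModCategory.

Section Dual.
Variables (k : fieldType) (A : falgType k).

(* Only the additive group of 'Hom(A, k^o) is kept: scalars are taken in A. *)
Definition alg_dual : Type := 'Hom(A, k^o).
HB.instance Definition _ := GRing.Zmodule.on alg_dual.

Definition dual_scale (a : A) (f : alg_dual) : alg_dual :=
  (f \o amulr a)%VF.

Lemma dual_scaleE a (f : alg_dual) x : dual_scale a f x = f (x * a).
Proof. by rewrite /dual_scale comp_lfunE lfunE. Qed.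

Fact dual_scaleA a b f : dual_scale a (dual_scale b f) = dual_scale (a * b) f.
Proof. by apply/lfunP => x; rewrite !dual_scaleE mulrA. Qed.
Fact dual_scale1 : left_id 1 dual_scale.
Proof. by move=> f; apply/lfunP => x; rewrite dual_scaleE mulr1. Qed.
Fact dual_scaleDr : right_distributive dual_scale +%R.
Proof.
by move=> a f g; apply/lfunP => x; rewrite add_lfunE !dual_scaleE add_lfunE.
Qed.
Fact dual_scaleDl f : {morph dual_scale^~ f : a b / a + b}.
Proof.
by move=> a b; apply/lfunP => x; rewrite add_lfunE !dual_scaleE mulrDr linearD.
Qed.
HB.instance Definition _ := GRing.Zmodule_isLmodule.Build A alg_dual
  dual_scaleA dual_scale1 dual_scaleDr dual_scaleDl.

Definition frobenius_algebra : Prop :=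
  isomorphic (C := mod_cat A) (A^o : lmodType A) (alg_dual : lmodType A).

End Dual.

(* I may be infinite, so finite sums are indexed by duplicate-free sequences. *)
Record direct_sum (I : eqType) (V : zmodType) (S : I -> {pred V}) : Prop :=
  DirectSum {
    dsum_zmod : forall i, zmod_closed (S i);
    dsum_span : forall v : V, exists (s : seq I) (x : I -> V),
      [/\ uniq s, forall i, x i \in S i & v = \sum_(i <- s) x i];
    dsum_indep : forall (s : seq I) (x : I -> V),
      uniq s -> (forall i, x i \in S i) -> \sum_(i <- s) x i = 0 ->
      forall i, i \in s -> x i = 0 }.

Lemma big_subset (I : eqType) (V : zmodType) (s t : seq I) (x : I -> V) :
  uniq s -> uniq t -> {subset s <= t} -> (forall i, i \notin s -> x i = 0) ->
  \sum_(i <- s) x i = \sum_(i <- t) x i.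
Proof.
move=> us ut st x0; rewrite [RHS](bigID (mem s)) /= [X in _ + X]big1 // addr0.
rewrite -[RHS]big_filter; apply: perm_big; apply: uniq_perm => //.
  exact: filter_uniq.
by move=> i; rewrite mem_filter; case: (boolP (i \in s)) => //= /st ->.
Qed.

Lemma direct_sum_proj (I : eqType) (V : zmodType) (S : I -> {pred V}) :
  direct_sum S -> exists c : V -> I -> V,
    [/\ forall v i, c v i \in S i,
        forall v, exists s : seq I,
          [/\ uniq s, v = \sum_(i <- s) c v i
            & forall i, i \notin s -> c v i = 0] &
        forall v (s : seq I) (x : I -> V), uniq s -> (forall i, x i \in S i) ->
          v = \sum_(i <- s) x i -> (forall i, i \notin s -> x i = 0) ->
          c v =1 x].
Proof.
case=> Sz Ssp Sind.
have S0 i : 0 \in S i by case: (Sz i).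
have SB i : {in S i &, forall x y, x - y \in S i} by case: (Sz i).
have /choice[c cP] : forall v : V, exists x : I -> V,
    (forall i, x i \in S i) /\ exists s : seq I,
    [/\ uniq s, v = \sum_(i <- s) x i & forall i, i \notin s -> x i = 0].
  move=> v; have [s [x [us xS ->]]] := Ssp v.
  exists (fun i => if i \in s then x i else 0); split.
    by move=> i; case: ifP.
  exists s; split=> //; last by move=> i /negbTE ->.
  by apply: eq_big_seq => i ->.
exists c; split; [by move=> v; case: (cP v) | by move=> v; case: (cP v) |].
move=> v s x us xS ev x0 i; have [cS [s' [us' ev' c0]]] := cP v.
pose t := undup (s ++ s').
have ut : uniq t by apply: undup_uniq.
have st : {subset s <= t} by move=> j js; rewrite mem_undup mem_cat js.
have st' : {subset s' <= t} by move=> j js; rewrite mem_undup mem_cat js orbT.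
have z : \sum_(j <- t) (c v j - x j) = 0.
  rewrite sumrB -(big_subset us ut st x0) -(big_subset us' ut st' c0).
  by rewrite -ev -ev' subrr.
case: (boolP (i \in t)) => [it|].
  apply/eqP; rewrite -subr_eq0; apply/eqP.
  by apply: (Sind t _ ut _ z) => // j; apply: SB.
by rewrite mem_undup mem_cat negb_or => /andP[/x0 -> /c0 ->].
Qed.

Record grading (k : fieldType) (G : groupType) (A : falgType k) :=
  Grading {
    gr :> G -> {vspace A};
    gr_dsum : direct_sum (fun g x => x \in gr g);
    gr_mul : forall g h x y,
      x \in gr g -> y \in gr h -> x * y \in gr (g * h)%g }.

Section Graded.
Variables (k : fieldType) (G : groupType) (A : falgType k).
Variable (gA : grading G A).

(* The unit of a graded algebra is automatically homogeneous of degree e. *)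
Fact gr_one : 1 \in gA 1%g.
Proof.
have [c [cS csp cun]] := direct_sum_proj (gr_dsum gA).
have [s [us e c0]] := csp 1.
have hom_r h (a : A) : a \in gA h -> a * c 1 1%g = a.
  move=> ah; pose y i := a * c 1 (h^-1 * i)%g.
  have yS i : y i \in gA i.
    by have := gr_mul ah (cS 1 (h^-1 * i)%g); rewrite mulVKg.
  have um : uniq [seq (h * j)%g | j <- s].
    by rewrite map_inj_uniq //; exact: mulgI.
  have ea : a = \sum_(i <- [seq (h * j)%g | j <- s]) y i.
    rewrite big_map -[LHS]mulr1 {1}e mulr_sumr; apply: eq_bigr => i _.
    by rewrite /y mulKg.
  have y0 i : i \notin [seq (h * j)%g | j <- s] -> y i = 0.
    move=> nis; rewrite /y c0 ?mulr0 //; apply: contra nis => his.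
    by apply/mapP; exists (h^-1 * i)%g; rewrite ?mulVKg.
  pose z i := if i == h then a else 0.
  have zS i : z i \in gA i by rewrite /z; case: eqP => [->|_] //; rewrite mem0v.
  have ez : a = \sum_(i <- [:: h]) z i by rewrite big_seq1 /z eqxx.
  have z0 i : i \notin [:: h] -> z i = 0 by rewrite inE /z => /negbTE ->.
  have := cun a [:: h] z isT zS ez z0 h.
  by rewrite (cun a _ y um yS ea y0) /y /z eqxx mulVg.
have all_r (a : A) : a * c 1 1%g = a.
  have [t [x [_ xS ->]]] := dsum_span (gr_dsum gA) a.
  by rewrite mulr_suml; apply: eq_bigr => i _; apply: (hom_r i); exact: xS.
by rewrite -[1]all_r mul1r; exact: cS.
Qed.

Fact gr_e_is_aspace : is_aspace (gA 1%g).
Proof.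
rewrite /is_aspace has_algid1 ?gr_one //=; apply/prodvP => x y xe ye.
by have := gr_mul xe ye; rewrite mulg1.
Qed.
(* An {aspace A} has its own unit [algid]; here it is that of A (gr_e_val1). *)
Definition gr_e_aspace : {aspace A} := ASpace gr_e_is_aspace.
Definition gr_e : falgType k := subvs_of gr_e_aspace.

Lemma gr_e_val1 : vsval (1 : gr_e) = 1.
Proof. by apply/eqP; rewrite algid_eq1 gr_one. Qed.
Lemma gr_e_valM (a b : gr_e) : vsval (a * b) = vsval a * vsval b.
Proof. by []. Qed.

(* The grading is a parameter so that the scalars gr_e can be inferred. *)
Definition res_e of grading G A := fun M : lmodType A => (M : Type).
HB.instance Definition _ M := GRing.Zmodule.on (res_e gA M).

Section ResE.
Variable M : lmodType A.
Definition res_e_scale (a : gr_e) (m : res_e gA M) : res_e gA M :=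
  vsval a *: (m : M).
Fact res_e_scaleA a b m :
  res_e_scale a (res_e_scale b m) = res_e_scale (a * b) m.
Proof. exact: scalerA. Qed.
Fact res_e_scale1 : left_id 1 res_e_scale.
Proof. by move=> m; rewrite /res_e_scale gr_e_val1; apply: scale1r. Qed.
Fact res_e_scaleDr : right_distributive res_e_scale +%R.
Proof. by move=> a m n; apply: scalerDr. Qed.
Fact res_e_scaleDl m : {morph res_e_scale^~ m : a b / a + b}.
Proof. by move=> a b; apply: scalerDl. Qed.
HB.instance Definition _ := GRing.Zmodule_isLmodule.Build gr_e (res_e gA M)
  res_e_scaleA res_e_scale1 res_e_scaleDr res_e_scaleDl.
End ResE.

(* The components are boolean predicates; as excluded middle is available, this
   covers every family of additive subgroups. *)
Record grmod := GrMod {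
  grmod_sort :> lmodType A;
  hc : G -> {pred grmod_sort};
  hc_dsum : direct_sum hc;
  hc_scale : forall g h (a : A) m,
    a \in gA g -> m \in hc h -> a *: m \in hc (g * h)%g }.

Arguments hc _ _ : clear implicits.

Definition grhom (M N : grmod) : Type :=
  {f : {linear M -> N} | forall g m, m \in hc M g -> f m \in hc N g}.

Lemma grhom_eq (M N : grmod) (f g : grhom M N) : sval f =1 sval g -> f = g.
Proof.
case: f g => [f Hf] [g Hg] /= /linear_eq fg; move: Hf Hg; rewrite fg => Hf Hg.
by rewrite (Prop_irrelevance Hf Hg).
Qed.

Definition grhom_id (M : grmod) : grhom M M.
Proof. by exists (mod_id M). Defined.
Definition grhom_comp (M N P : grmod) (f : grhom N P) (h : grhom M N) :
  grhom M P.
Proof.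
exists (mod_comp (sval f) (sval h)) => g m Hm.
exact: (proj2_sig f g _ (proj2_sig h g m Hm)).
Defined.

Definition grmod_cat : category.
Proof.
refine (@Category grmod grhom grhom_id grhom_comp _ _ _) => *; exact: grhom_eq.
Defined.

Section DegreeE.
Variable M : grmod.

Inductive hc_e : predArgType := HcE (m : M) & m \in hc M 1%g.
Definition hc_e_val (x : hc_e) : M := let: HcE m _ := x in m.
HB.instance Definition _ := [isSub of hc_e for hc_e_val].
HB.instance Definition _ := [Choice of hc_e by <:].

Fact hc_e_zmod_closed : zmod_closed (hc M 1%g).
Proof. exact: dsum_zmod (hc_dsum M) 1%g. Qed.
HB.instance Definition _ :=
  GRing.isZmodClosed.Build M (hc M 1%g) hc_e_zmod_closed.
HB.instance Definition _ := [SubChoice_isSubZmodule of hc_e by <:].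

Fact hc_e_scale_subproof (a : gr_e) (x : hc_e) :
  vsval a *: val x \in hc M 1%g.
Proof. by have := hc_scale (subvsP a) (valP x); rewrite mulg1. Qed.
Definition hc_e_scale (a : gr_e) (x : hc_e) : hc_e :=
  HcE (hc_e_scale_subproof a x).
Fact hc_e_scaleA a b x : hc_e_scale a (hc_e_scale b x) = hc_e_scale (a * b) x.
Proof. exact/val_inj/scalerA. Qed.
Fact hc_e_scale1 : left_id 1 hc_e_scale.
Proof.
move=> x; apply/val_inj.
by rewrite -[LHS]/(vsval 1 *: val x) gr_e_val1 scale1r.
Qed.
Fact hc_e_scaleDr : right_distributive hc_e_scale +%R.
Proof. by move=> a x y; apply/val_inj/scalerDr. Qed.
Fact hc_e_scaleDl x : {morph hc_e_scale^~ x : a b / a + b}.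
Proof. by move=> a b; apply/val_inj/scalerDl. Qed.
HB.instance Definition _ := GRing.Zmodule_isLmodule.Build gr_e hc_e
  hc_e_scaleA hc_e_scale1 hc_e_scaleDr hc_e_scaleDl.
End DegreeE.

Section DegreeEMap.
Variables (M N : grmod) (f : grhom M N).
Definition hc_e_map (x : hc_e M) : hc_e N :=
  HcE (proj2_sig f 1%g (val x) (valP x)).
Fact hc_e_map_linear : linear hc_e_map.
Proof. by move=> a x y; apply/val_inj/linearP. Qed.
HB.instance Definition _ :=
  GRing.isLinear.Build gr_e (hc_e M) (hc_e N) _ hc_e_map hc_e_map_linear.
Definition hc_e_lin : {linear hc_e M -> hc_e N} := hc_e_map.
End DegreeEMap.

Definition degree_e_functor : functor grmod_cat (mod_cat gr_e).
Proof.
refine (@Functor grmod_cat (mod_cat gr_e) (fun M : grmod => hc_e M : lmodType _)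
  hc_e_lin _ _).
- by move=> M; apply: linear_eq => x; apply: val_inj.
- by move=> M N P f h; apply: linear_eq => x; apply: val_inj.
Defined.

Definition grmod_regular : grmod :=
  @GrMod (A^o : lmodType A) (fun g x => x \in gA g) (gr_dsum gA)
    (@gr_mul _ _ _ gA).

Definition dual_hc (g : G) : {pred alg_dual A} :=
  fun f => `[< forall h, h != g^-1%g -> forall x, x \in gA h -> f x = 0 >].

Lemma gr_proj : exists (c : G -> {linear A -> A}) (s : seq G),
  [/\ uniq s, forall g x, c g x \in gA g,
      forall x, x = \sum_(g <- s) c g x
    & forall g h x, x \in gA h -> c g x = if g == h then x else 0].
Proof.
have [c [cS csp cun]] := direct_sum_proj (gr_dsum gA).
have c_lin g : linear (c^~ g).
  move=> a x y.
  have [s [us ex x0]] := csp x; have [t [ut ey y0]] := csp y.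
  pose r := undup (s ++ t).
  have ur : uniq r by apply: undup_uniq.
  have sr : {subset s <= r} by move=> j js; rewrite mem_undup mem_cat js.
  have tr : {subset t <= r} by move=> j js; rewrite mem_undup mem_cat js orbT.
  apply: (cun _ r (fun i => a *: c x i + c y i) ur) => [i||i].
  - by apply: memvD; [apply: memvZ|]; exact: cS.
  - rewrite big_split /= -scaler_sumr -(big_subset us ur sr x0).
    by rewrite -(big_subset ut ur tr y0) -ex -ey.
  - rewrite mem_undup mem_cat negb_or => /andP[/x0 -> /y0 ->].
    by rewrite scaler0 addr0.
pose cg g : {linear A -> A} :=
  HB.pack (c^~ g) (GRing.isLinear.Build k A A _ (c^~ g) (c_lin g)).
have /choice[supp suppP] := csp.
pose s := undup (flatten [seq supp b | b <- vbasis {:A}%VS]).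
have us : uniq s by apply: undup_uniq.
have c0 g x : g \notin s -> c x g = 0.
  rewrite mem_undup => gs; rewrite -[c x g]/(cg g x).
  rewrite (coord_vbasis (memvf x)) linear_sum big1 // => i _.
  rewrite linearZ /=; have [_ _ ->] := suppP (vbasis {:A}%VS)`_i.
    by rewrite scaler0.
  apply: contra gs => gi; apply/flattenP; exists (supp (vbasis {:A}%VS)`_i) => //.
  by apply/map_f/mem_nth; rewrite size_tuple.
exists cg, s; split=> //.
- by move=> g x; exact: cS.
- move=> x; have [t [ut ex x0]] := csp x; rewrite {1}ex.
  pose r := undup (s ++ t).
  have ur : uniq r by apply: undup_uniq.
  have sr : {subset s <= r} by move=> j js; rewrite mem_undup mem_cat js.
  have tr : {subset t <= r} by move=> j js; rewrite mem_undup mem_cat js orbT.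
  rewrite (big_subset ut ur tr x0) -(big_subset us ur sr) // => i.
  exact: c0.
- move=> g h x xh; pose z i := if i == h then x else 0.
  apply: (cun x [:: h] z) => // [i||i].
  + by change (z i \in gA i); rewrite /z; case: eqP => [->|_] //; rewrite mem0v.
  + by rewrite big_seq1 /z eqxx.
  + by rewrite inE /z => /negbTE ->.
Qed.

Fact dual_hc_dsum : direct_sum dual_hc.
Proof.
split.
- move=> g; split; first by apply/asboolP => h _ x _; rewrite zero_lfunE.
  move=> f1 f2 /asboolP H1 /asboolP H2; apply/asboolP => h hg x xh.
  by rewrite add_lfunE opp_lfunE (H1 h) // (H2 h) // subrr.
- move=> f; have [c [s [us cS csum cE]]] := gr_proj.
  exists [seq g^-1%g | g <- s], (fun g => (f \o linfun (c g^-1%g))%VF); split.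
  + by rewrite map_inj_uniq //; exact: invg_inj.
  + move=> g; apply/asboolP => h hg x xh; rewrite comp_lfunE lfunE /=.
    by rewrite (cE _ h) // eq_sym (negbTE hg) linear0.
  + apply/lfunP => x; rewrite big_map sum_lfunE {1}(csum x) linear_sum.
    by apply: eq_bigr => g _; rewrite comp_lfunE lfunE /= invgK.
- move=> s F us FS F0 i is_; apply/lfunP => x; rewrite zero_lfunE.
  have [t [y [_ yS ->]]] := dsum_span (gr_dsum gA) x.
  rewrite linear_sum big1 // => g _; have yg : y g \in gA g by exact: yS.
  have [ig|ng] := eqVneq g i^-1%g; last first.
    by have /asboolP := FS i; apply; [exact: ng | exact: yg].
  have := congr1 (fun f : alg_dual A => f (y g)) F0.
  rewrite sum_lfunE zero_lfunE (bigD1_seq i) //= big1 ?addr0 // => j ji.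
  have /asboolP := FS j; apply; last exact: yg.
  by rewrite ig (inj_eq invg_inj) eq_sym.
Qed.

Fact dual_hc_scale g h (a : A) (f : alg_dual A) :
  a \in gA g -> f \in dual_hc h -> a *: f \in dual_hc (g * h)%g.
Proof.
move=> ag /asboolP fh; apply/asboolP => l ln x xl.
rewrite -[a *: f]/(dual_scale a f) dual_scaleE.
apply: (fh (l * g)%g); last exact: gr_mul.
apply: contra ln => /eqP e; apply/eqP.
by rewrite invgM -e mulgK.
Qed.

Definition grmod_dual : grmod :=
  @GrMod (alg_dual A : lmodType A) dual_hc dual_hc_dsum dual_hc_scale.

Definition graded_frobenius : Prop :=
  isomorphic (C := grmod_cat) grmod_regular grmod_dual.

End Graded.

(* Main.v *)
From HB Require Import structures.
From mathcomp Require Import all_boot all_algebra falgebra.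
From mathcomp Require Import boolp.
Require Import Defs.

Set Implicit Arguments.
Unset Strict Implicit.
Unset Printing Implicit Defensive.

Import GRing.Theory.
Local Open Scope ring_scope.

(** Write pi : A -> A_e for the projection onto the component of degree e; it
    is A_e-linear on both sides. For every graded algebra, (-)_e has a right
    adjoint, the coinduction functor N |-> Hom_(A_e)(A, N), a map lying in
    degree g when it kills A_h for all h <> g^-1 (coind_right_adjoint). So
    (-)_e is Frobenius exactly when coinduction is also a left adjoint of it.

    For the first assertion, the image lam of 1 under an isomorphism A ~ A^* is
    a linear form that vanishes on A_g for g <> e, and every linear form on A is
    lam(- a) for a unique a (graded_frobenius_form). Its restriction to A_e is nondegenerate
    too, which upgrades this to: every A_e-linear map A -> A_e is pi(- a) for
    some a (pi_e_represents). As A is finitely generated and projective over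
    A_e, it has a dual basis, whose coordinate maps are therefore of the form
    pi(- a_i); so x = sum_i pi(x a_i) x_i for all x. Nondegeneracy gives the
    mirror identity y = sum_i a_i pi(x_i y), and everything can be made
    homogeneous (frobenius_system_exists). Such a Frobenius system makes
    coinduction a left adjoint (coind_left_adjoint): the unit sends n to
    x |-> pi(x) n, the counit sends f : A -> M_e to sum_i a_i f(x_i), and the
    counit is A-linear because sum_i a_i (x) x_i is a Casimir element
    (casimir).

    For the second, let H be both a left and a right adjoint of (-)_e. As A
    corepresents M |-> M_e = Hom_(A_e)(A_e, M_e), the left adjoint H sends A_e
    to A (regular_left_adjoint); as a right adjoint, H agrees with coinduction. With
    A_e ~ A_e^*, this gives

      A ~ H(A_e) ~ Hom_(A_e)(A, A_e) ~ Hom_(A_e)(A, A_e^* ) ~ A^*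

    in the category of graded modules, the last step being the
    hom-tensor adjunction (dual_coind_isomorphic). *)

(** * Uniqueness of adjoints *)

(** Each composite of the two mates of the identities is again the mate of an
    identity, by naturality in the first variable. *)
Lemma right_adjoint_unique (C D : category) (F : functor C D)
    (H H' : functor D C) (N : D) :
  left_adjoint F H -> left_adjoint F H' -> isomorphic (H N) (H' N).
Proof.
move=> [phi [phiB phiN]] [psi [psiB psiN]].
have phiNl X X' (a : hom X' X) (f : hom (F X) N) :
    catcomp (phi X N f) a = phi X' N (catcomp f (fmap F a)).
  by have := phiN X X' N N a (idm N) f; rewrite !comp1m fmap1 comp1m => <-.
have psiNl X X' (a : hom X' X) (f : hom (F X) N) :
    catcomp (psi X N f) a = psi X' N (catcomp f (fmap F a)).
  by have := psiN X X' N N a (idm N) f; rewrite !comp1m fmap1 comp1m => <-.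
have [f Ef] : exists f, phi (H N) N f = idm _.
  by have [g _ gK] := phiB (H N) N; exists (g (idm _)).
have [f' Ef'] : exists f', psi (H' N) N f' = idm _.
  by have [g _ gK] := psiB (H' N) N; exists (g (idm _)).
have phiI := bij_inj (phiB _ _); have psiI := bij_inj (psiB _ _).
exists (psi _ _ f), (phi _ _ f'); split.
- rewrite phiNl -Ef; congr (phi _ _ _); apply: psiI.
  by rewrite -psiNl Ef' comp1m.
- rewrite psiNl -Ef'; congr (psi _ _ _); apply: phiI.
  by rewrite -phiNl Ef comp1m.
Qed.

(** Yoneda: H N corepresents Z |-> Hom(N, F Z), and so does X. The object X need
    not be the value of a functor, which is how A itself will be recognized. *)
Lemma left_adjoint_corepresents (C D : category) (F : functor C D)
    (H : functor D C) (N : D) (X : C)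
    (psi : forall Z : C, hom X Z -> hom N (F Z)) :
  left_adjoint H F -> (forall Z, bijective (psi Z)) ->
  (forall (Z Z' : C) (b : hom Z Z') f,
     psi Z' (catcomp b f) = catcomp (fmap F b) (psi Z f)) ->
  isomorphic X (H N).
Proof.
move=> [phi [phiB phiN]] psiB psiN.
have phiNr Y Y' (b : hom Y Y') (f : hom (H N) Y) :
    phi N Y' (catcomp b f) = catcomp (fmap F b) (phi N Y f).
  by have := phiN N N Y Y' (idm N) b f; rewrite fmap1 !compm1.
have [f Ef] : exists f, psi (H N) f = phi N (H N) (idm _).
  by have [g _ gK] := psiB (H N); exists (g (phi N (H N) (idm _))).
have [f' Ef'] : exists f', phi N X f' = psi X (idm X).
  by have [g _ gK] := phiB N X; exists (g (psi X (idm X))).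
exists f, f'; split.
- by apply: (bij_inj (psiB X)); rewrite psiN Ef -phiNr compm1.
- by apply: (bij_inj (phiB N (H N))); rewrite phiNr Ef' -psiN compm1.
Qed.

Lemma isomorphic_trans (C : category) (X Y Z : C) :
  isomorphic X Y -> isomorphic Y Z -> isomorphic X Z.
Proof.
move=> [f [g [gf fg]]] [f' [g' [gf' fg']]].
exists (catcomp f' f), (catcomp g g'); split.
- by rewrite -compA (compA g') gf' comp1m gf.
- by rewrite -compA (compA f) fg comp1m fg'.
Qed.

Lemma isomorphic_sym (C : category) (X Y : C) :
  isomorphic X Y -> isomorphic Y X.
Proof. by move=> [f [g [gf fg]]]; exists g, f. Qed.

Lemma isomorphic_fmap (C D : category) (F : functor C D) (X Y : C) :
  isomorphic X Y -> isomorphic (F X) (F Y).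
Proof.
move=> [f [g [gf fg]]]; exists (fmap F f), (fmap F g).
by rewrite -!fmapM gf fg !fmap1.
Qed.

(** * Homogeneous components *)

Local Arguments hc {k G A gA} M g : rename.

Section Components.
Variables (I : eqType) (V : zmodType) (S : I -> {pred V}).
Hypothesis dS : direct_sum S.

Definition component (i : I) (v : V) : V :=
  sval (cid (direct_sum_proj dS)) v i.

Lemma component_in i v : component i v \in S i.
Proof. by rewrite /component; case: cid => c [cS _ _] /=; exact: cS. Qed.

Lemma homog0 i : 0 \in S i.
Proof. by case: (dsum_zmod dS i). Qed.

(** Together with additivity, this characterizes the components: by
    direct_sum_ind, identities between them are checked on homogeneous
    elements. *)
Lemma component_homog i j v :
  v \in S i -> component j v = if j == i then v else 0.
Proof.
move=> vi; rewrite /component; case: cid => c [_ _ cun] /=.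
apply: (cun v [:: i] (fun j => if j == i then v else 0)) => // [l||l].
- by case: eqP => [->|_] //; exact: homog0.
- by rewrite big_seq1 eqxx.
- by rewrite inE => /negbTE ->.
Qed.

Lemma component_id i v : v \in S i -> component i v = v.
Proof. by move/component_homog=> ->; rewrite eqxx. Qed.

Lemma component_off i j v : j != i -> v \in S i -> component j v = 0.
Proof. by move=> ji /component_homog->; rewrite (negbTE ji). Qed.

Fact component_zmod_morphism i : zmod_morphism (component i).
Proof.
move=> u v; rewrite /component; case: cid => c [cS csp cun] /=.
have [s [us eu u0]] := csp u; have [t [ut ev v0]] := csp v.
pose r := undup (s ++ t).
have ur : uniq r by apply: undup_uniq.
have sr : {subset s <= r} by move=> j js; rewrite mem_undup mem_cat js.
have tr : {subset t <= r} by move=> j jt; rewrite mem_undup mem_cat jt orbT.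
apply: (cun _ r (fun i => c u i - c v i) ur) => [j||j].
- by case: (dsum_zmod dS j) => _; apply.
- by rewrite sumrB -(big_subset us ur sr u0) -(big_subset ut ur tr v0) -eu -ev.
- by rewrite mem_undup mem_cat negb_or => /andP[/u0 -> /v0 ->]; rewrite subrr.
Qed.
HB.instance Definition _ i :=
  GRing.isZmodMorphism.Build V V (component i) (component_zmod_morphism i).

Lemma componentD i u v :
  component i (u + v) = component i u + component i v.
Proof. exact: raddfD. Qed.

Lemma component_big i (J : Type) (s : seq J) (F : J -> V) :
  component i (\sum_(j <- s) F j) = \sum_(j <- s) component i (F j).
Proof. exact: raddf_sum. Qed.

Lemma direct_sum_ind (P : V -> Prop) :
  P 0 -> (forall u v, P u -> P v -> P (u + v)) ->
  (forall i v, v \in S i -> P v) -> forall v, P v.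
Proof.
move=> P0 PD PS v; have [s [x [_ xS ->]]] := dsum_span dS v.
by apply: big_ind => // i _; apply: PS (xS i).
Qed.

End Components.

Section Graded.
Variables (k : fieldType) (G : groupType) (A : falgType k) (gA : grading G A).
Notation Ae := (gr_e gA).

Lemma component_scale (M : grmod gA) g h (a : A) (m : M) : a \in gA g ->
  component (hc_dsum M) (g * h)%g (a *: m) = a *: component (hc_dsum M) h m.
Proof.
move=> ag; elim/(direct_sum_ind (hc_dsum M)): m => [|u v Hu Hv|l m ml].
- by rewrite !(raddf0, scaler0).
- by rewrite scalerDr !componentD Hu Hv scalerDr.
rewrite (component_homog _ _ ml) (component_homog _ _ (hc_scale ag ml)).
by rewrite (inj_eq (mulgI g)); case: eqP; rewrite ?scaler0.
Qed.

Lemma component_mul g h (a x : A) : a \in gA g ->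
  component (gr_dsum gA) (g * h)%g (a * x) = a * component (gr_dsum gA) h x.
Proof. exact: (@component_scale (grmod_regular gA)). Qed.

(** Finite dimension enters here: one finite set of degrees serves all x. *)
Lemma component_sum : exists s : seq G,
  uniq s /\ forall x : A, x = \sum_(g <- s) component (gr_dsum gA) g x.
Proof.
have [c [s [us cS csum _]]] := gr_proj gA.
exists s; split=> // x; rewrite {1}(csum x); apply: eq_big_seq => g gs.
rewrite [in RHS](csum x) component_big (bigD1_seq g) //= big1 => [|i ig].
  by rewrite component_id ?addr0.
by rewrite (component_off (gr_dsum gA) _ (cS i x)) // eq_sym.
Qed.

Lemma gr_e_in (b : Ae) : vsval b \in gA 1%g.
Proof. exact: subvsP. Qed.

Definition pi_e (x : A) : Ae := Subvs (component_in (gr_dsum gA) 1%g x).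

Lemma val_pi_e x : vsval (pi_e x) = component (gr_dsum gA) 1%g x.
Proof. by []. Qed.

Lemma gr_e_inj : injective (vsval : Ae -> A).
Proof. exact: val_inj. Qed.

Fact pi_e_zmod_morphism : zmod_morphism pi_e.
Proof. by move=> x y; apply: gr_e_inj; rewrite !val_pi_e raddfB. Qed.
HB.instance Definition _ := GRing.isZmodMorphism.Build A Ae pi_e
  pi_e_zmod_morphism.

Lemma pi_eD x y : pi_e (x + y) = pi_e x + pi_e y.
Proof. exact: raddfD. Qed.

Lemma pi_e_sum (J : Type) (s : seq J) (F : J -> A) :
  pi_e (\sum_(j <- s) F j) = \sum_(j <- s) pi_e (F j).
Proof. exact: raddf_sum. Qed.

Lemma pi_eB x y : pi_e (x - y) = pi_e x - pi_e y.
Proof. exact: raddfB. Qed.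

Lemma pi_e_off g x : g != 1%g -> x \in gA g -> pi_e x = 0.
Proof.
move=> g1 xg; apply: gr_e_inj; rewrite val_pi_e.
by rewrite (component_off (gr_dsum gA) _ xg) // eq_sym.
Qed.

Lemma pi_eMl (b : Ae) x : pi_e (vsval b * x) = b * pi_e x.
Proof.
apply: gr_e_inj; rewrite gr_e_valM !val_pi_e.
by have := component_mul 1%g x (gr_e_in b); rewrite mulg1.
Qed.

(** The right-hand counterpart of pi_eMl is checked on homogeneous x because
    component_mul only speaks of homogeneous left factors. *)
Lemma pi_eMr (b : Ae) x : pi_e (x * vsval b) = pi_e x * b.
Proof.
elim/(direct_sum_ind (gr_dsum gA)): x => [|x y Hx Hy|g x xg].
- by rewrite mul0r raddf0 mul0r.
- by rewrite mulrDl !pi_eD Hx Hy mulrDl.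
have xbg := gr_mul xg (gr_e_in b); rewrite mulg1 in xbg.
have [g1|g1] := eqVneq g 1%g; last first.
  by rewrite (pi_e_off g1 xbg) (pi_e_off g1 xg) mul0r.
apply: gr_e_inj; rewrite gr_e_valM !val_pi_e -g1.
by rewrite !component_id.
Qed.

(** * The coinduction functor *)

Section Coinduction.
Variable N : lmodType Ae.

(** The A_e-linear maps from A to N, as maps on A itself, so that their
    arguments can be multiplied in A. *)
Record coind := Coind {
  coind_fun :> A -> N;
  coind_add : {morph coind_fun : x y / x + y};
  coind_scale : forall (b : Ae) x, coind_fun (vsval b * x) = b *: coind_fun x }.

Lemma coind_eq (f g : coind) : f =1 g -> f = g.
Proof.
case: f g => [f fD fZ] [g gD gZ] /= /funext fg.
rewrite -/(f = g) in fg; move: fD fZ gD gZ; rewrite fg => fD fZ gD gZ.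
by rewrite (Prop_irrelevance fD gD) (Prop_irrelevance fZ gZ).
Qed.

HB.instance Definition _ := gen_eqMixin coind.
HB.instance Definition _ := gen_choiceMixin coind.

Fact coind_zmod_morphism (f : coind) : zmod_morphism f.
Proof.
have fB x y : f (x - y) = f x - f y.
  by apply/eqP; rewrite eq_sym subr_eq -coind_add subrK.
exact: fB.
Qed.
HB.instance Definition _ (f : coind) :=
  GRing.isZmodMorphism.Build A N (coind_fun f) (coind_zmod_morphism f).

Lemma coind_sum (f : coind) (J : Type) (s : seq J) (F : J -> A) :
  f (\sum_(j <- s) F j) = \sum_(j <- s) f (F j).
Proof. exact: raddf_sum. Qed.

Definition coind_zero : coind.
Proof.
by exists (fun=> 0) => [x y|b x]; rewrite ?addr0 ?scaler0.
Defined.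
Definition coind_opp (f : coind) : coind.
Proof.
exists (fun x => - f x) => [x y|b x]; first by rewrite coind_add opprD.
by rewrite coind_scale scalerN.
Defined.
Definition coind_plus (f g : coind) : coind.
Proof.
exists (fun x => f x + g x) => [x y|b x]; first by rewrite !coind_add addrACA.
by rewrite !coind_scale scalerDr.
Defined.

Fact coind_addA : associative coind_plus.
Proof. by move=> f g h; apply: coind_eq => x; apply: addrA. Qed.
Fact coind_addC : commutative coind_plus.
Proof. by move=> f g; apply: coind_eq => x; apply: addrC. Qed.
Fact coind_add0 : left_id coind_zero coind_plus.
Proof. by move=> f; apply: coind_eq => x; apply: add0r. Qed.
Fact coind_addN : left_inverse coind_zero coind_opp coind_plus.
Proof. by move=> f; apply: coind_eq => x; apply: addNr. Qed.
HB.instance Definition _ := GRing.isZmodule.Build coind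
  coind_addA coind_addC coind_add0 coind_addN.

Definition coind_act (a : A) (f : coind) : coind.
Proof.
exists (fun x => f (x * a)) => [x y|b x]; first by rewrite mulrDl coind_add.
by rewrite -mulrA coind_scale.
Defined.

Fact coind_actA a b f : coind_act a (coind_act b f) = coind_act (a * b) f.
Proof. by apply: coind_eq => x /=; rewrite mulrA. Qed.
Fact coind_act1 : left_id 1 coind_act.
Proof. by move=> f; apply: coind_eq => x /=; rewrite mulr1. Qed.
Fact coind_actDr : right_distributive coind_act +%R.
Proof. by move=> a f g; apply: coind_eq => x. Qed.
Fact coind_actDl f : {morph coind_act^~ f : a b / a + b}.
Proof. by move=> a b; apply: coind_eq => x /=; rewrite mulrDr coind_add. Qed.
HB.instance Definition _ := GRing.Zmodule_isLmodule.Build A coind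
  coind_actA coind_act1 coind_actDr coind_actDl.

Lemma coindE0 x : (0 : coind) x = 0. Proof. by []. Qed.
Lemma coindED (f g : coind) x : (f + g) x = f x + g x. Proof. by []. Qed.
Lemma coindEN (f : coind) x : (- f) x = - f x. Proof. by []. Qed.
Lemma coindEZ a (f : coind) x : (a *: f) x = f (x * a). Proof. by []. Qed.
Lemma coindEsum (J : Type) (s : seq J) (F : J -> coind) x :
  (\sum_(j <- s) F j) x = \sum_(j <- s) F j x.
Proof. by elim/big_rec2: _ => //= j _ y _ <-. Qed.

(** The convention of the grading of A^*: f maps A_(g^-1) to degree e. *)
Definition coind_hc (g : G) : {pred coind} := fun f =>
  `[< forall h, h != g^-1%g -> forall x, x \in gA h -> f x = 0 >].

Lemma coind_hcP g (f : coind) : reflect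
  (forall h, h != g^-1%g -> forall x, x \in gA h -> f x = 0)
  (f \in coind_hc g).
Proof. exact: asboolP. Qed.

Definition coind_part (g : G) (f : coind) : coind.
Proof.
exists (fun x => f (component (gr_dsum gA) g^-1%g x)) => [x y|b x].
  by rewrite componentD coind_add.
rewrite -coind_scale; congr (f _).
by have := component_mul g^-1%g x (gr_e_in b); rewrite mul1g.
Defined.

Fact coind_hc_dsum : direct_sum coind_hc.
Proof.
split.
- move=> g; split; first exact/coind_hcP.
  move=> f1 f2 /coind_hcP H1 /coind_hcP H2; apply/coind_hcP => h hg x xh.
  by rewrite coindED coindEN (H1 h) // (H2 h) // subrr.
- move=> f; have [s [us ssum]] := component_sum.
  exists [seq g^-1%g | g <- s], (coind_part ^~ f); split.
  + by rewrite map_inj_uniq //; exact: invg_inj.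
  + move=> g; apply/coind_hcP => h hg x xh.
    by rewrite /= (component_off (gr_dsum gA) _ xh) ?raddf0 // eq_sym.
  + apply: coind_eq => x; rewrite coindEsum big_map {1}(ssum x) raddf_sum.
    by apply: eq_bigr => g _ /=; rewrite invgK.
- move=> s F us FS F0 i is_; apply: coind_eq.
  elim/(direct_sum_ind (gr_dsum gA)) => [|x y Hx Hy|g x xg].
  + by rewrite raddf0.
  + by rewrite coind_add Hx Hy addr0.
  have [ig|ng] := eqVneq g i^-1%g; last first.
    by have /coind_hcP := FS i; apply; [exact: ng | exact: xg].
  have := congr1 (fun f : coind => f x) F0.
  rewrite coindEsum (bigD1_seq i) //= big1 ?addr0 // => j ji.
  have /coind_hcP := FS j; apply; last exact: xg.
  by rewrite ig (inj_eq invg_inj) eq_sym.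
Qed.

Fact coind_hc_scale g h (a : A) (f : coind) :
  a \in gA g -> f \in coind_hc h -> a *: f \in coind_hc (g * h)%g.
Proof.
move=> ag /coind_hcP fh; apply/coind_hcP => l ln x xl.
rewrite coindEZ; apply: (fh (l * g)%g); last exact: gr_mul.
by apply: contra ln => /eqP e; apply/eqP; rewrite invgM -e mulgK.
Qed.

Definition grmod_coind : grmod gA :=
  @GrMod _ _ _ gA (coind : lmodType A) coind_hc coind_hc_dsum coind_hc_scale.

End Coinduction.

Definition coind_map (N N' : lmodType Ae) (u : {linear N -> N'}) (f : coind N) :
  coind N'.
Proof.
exists (fun x => u (f x)) => [x y|b x]; first by rewrite coind_add raddfD.
by rewrite coind_scale linearZ.
Defined.

Fact coind_map_linear (N N' : lmodType Ae) (u : {linear N -> N'}) :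
  linear (coind_map u : coind N -> coind N').
Proof. by move=> a f g; apply: coind_eq => x; exact: raddfD. Qed.
HB.instance Definition _ N N' u :=
  GRing.isLinear.Build A (coind N) (coind N') _ (coind_map u)
    (@coind_map_linear N N' u).

Definition coind_grhom (N N' : lmodType Ae) (u : {linear N -> N'}) :
  grhom (grmod_coind N) (grmod_coind N').
Proof.
exists (coind_map u : {linear coind N -> coind N'}) => g f /coind_hcP fg.
by apply/coind_hcP => h hg x xh /=; rewrite (fg h) ?raddf0.
Defined.

Definition coind_functor : functor (mod_cat Ae) (grmod_cat gA).
Proof.
refine (@Functor (mod_cat Ae) (grmod_cat gA)
  (fun N : lmodType Ae => grmod_coind N) coind_grhom _ _).
- by move=> N; apply: grhom_eq => f; apply: coind_eq.
- by move=> N N' N'' u v; apply: grhom_eq => f; apply: coind_eq.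
Defined.

(** * Coinduction is right adjoint to the component of degree e *)

Section DegreeE.
Variable M : grmod gA.

Definition deg_e (m : M) : hc_e M := HcE (component_in (hc_dsum M) 1%g m).

Lemma deg_e_zmod_morphism : zmod_morphism deg_e.
Proof. by move=> m n; apply: val_inj; exact: raddfB. Qed.
HB.instance Definition _ := GRing.isZmodMorphism.Build M (hc_e M) deg_e
  deg_e_zmod_morphism.

Lemma deg_eD m n : deg_e (m + n) = deg_e m + deg_e n.
Proof. exact: raddfD. Qed.

Lemma deg_e_val (m : hc_e M) : deg_e (val m) = m.
Proof. by apply: val_inj; exact: component_id (valP m). Qed.

Lemma deg_e_off g m : g != 1%g -> m \in hc M g -> deg_e m = 0.
Proof.
by move=> g1 mg; apply: val_inj; apply: component_off mg; rewrite eq_sym.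
Qed.

Lemma deg_e_scale (b : Ae) m : deg_e (vsval b *: m) = b *: deg_e m.
Proof.
apply: val_inj; have := component_scale 1%g m (gr_e_in b).
by rewrite mul1g.
Qed.
End DegreeE.

Lemma deg_e_grhom (M M' : grmod gA) (a : grhom M M') m :
  deg_e (sval a m) = hc_e_map a (deg_e m).
Proof.
elim/(direct_sum_ind (hc_dsum M)): m => [|u v Hu Hv|g m mg].
- by rewrite !raddf0.
- by rewrite deg_eD [sval a _]raddfD deg_eD Hu Hv [RHS]raddfD.
have amg := proj2_sig a g m mg.
have [g1|g1] := eqVneq g 1%g; last by rewrite !(deg_e_off g1) // raddf0.
by subst g; apply: val_inj; rewrite /= !component_id.
Qed.

(** The transpose of u : M_e -> N sends m to x |-> u((x m)_e). *)
Section ToCoind.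
Variables (M : grmod gA) (N : lmodType Ae) (u : {linear hc_e M -> N}).

Definition to_coind_fun (m : M) : coind N.
Proof.
exists (fun x => u (deg_e (x *: m))) => [x y|b x].
  by rewrite scalerDl !raddfD.
by rewrite -scalerA deg_e_scale linearZ.
Defined.

Fact to_coind_linear : linear to_coind_fun.
Proof.
move=> a m n; apply: coind_eq => x; rewrite coindED coindEZ /=.
by rewrite scalerDr !raddfD scalerA.
Qed.
HB.instance Definition _ :=
  GRing.isLinear.Build A M (coind N) _ to_coind_fun to_coind_linear.

Definition to_coind : grhom M (grmod_coind N).
Proof.
exists (to_coind_fun : {linear M -> coind N}) => g m mg.
apply/coind_hcP => h hg x xh /=.
rewrite (@deg_e_off M (h * g)%g) ?raddf0 ?(hc_scale xh mg) //.
by apply: contra hg => /eqP e; apply/eqP; rewrite -[LHS](mulgK g) e mul1g.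
Defined.
End ToCoind.

(** Transposing back is evaluation at 1. *)
Section OfCoind.
Variables (M : grmod gA) (N : lmodType Ae) (w : grhom M (grmod_coind N)).

Definition of_coind_fun (m : hc_e M) : N := (sval w (val m) : coind N) 1.

Fact of_coind_linear : linear of_coind_fun.
Proof.
move=> b m n; rewrite /of_coind_fun.
rewrite -[val _]/(vsval b *: val m + val n) linearP coindED coindEZ mul1r.
by rewrite -[vsval b]mulr1 coind_scale.
Qed.
HB.instance Definition _ := GRing.isLinear.Build Ae (hc_e M) N _ of_coind_fun
  of_coind_linear.
Definition of_coind : {linear hc_e M -> N} := of_coind_fun.
End OfCoind.

(** Evaluation at 1 only sees the part of degree e, as 1 lies in A_e; this is
    why nothing is lost by restricting a transpose to M_e. *)
Lemma coind_eval1 N (f : grmod_coind N) :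
  (val (deg_e f) : coind N) 1 = (f : coind N) 1.
Proof.
elim/(direct_sum_ind (hc_dsum (grmod_coind N))): f => [|f h Hf Hh|g f fg].
- by rewrite raddf0.
- by rewrite raddfD [LHS]coindED Hf Hh -coindED.
have [g1|g1] := eqVneq g 1%g; first by subst g; rewrite /= component_id.
rewrite (deg_e_off g1 fg) coindE0; move/coind_hcP: fg => /(_ 1%g) -> //.
  by rewrite eq_sym invg_eq1.
exact: gr_one.
Qed.

Lemma coind_right_adjoint : left_adjoint (degree_e_functor gA) coind_functor.
Proof.
exists to_coind; split.
- move=> M N; exists (@of_coind M N) => [u|w].
  + apply: linear_eq => m; rewrite /= /of_coind_fun /= scale1r.
    by rewrite deg_e_val.
  + apply: grhom_eq => m; apply: coind_eq => x /=.
    rewrite /of_coind_fun.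
    rewrite -[LHS]/((val (hc_e_map w (deg_e (x *: m))) : coind N) 1).
    by rewrite -deg_e_grhom coind_eval1 linearZ coindEZ mul1r.
- move=> M M' N N' a b u; apply: grhom_eq => m; apply: coind_eq => x /=.
  by rewrite -deg_e_grhom linearZ.
Qed.

(** * Frobenius systems make coinduction a left adjoint *)

(** A triple (g, a, x) of the list stands for a pair of homogeneous elements a
    and x of degrees g^-1 and g. The two families (a_t) and (x_t) generate A
    over A_e, from the right and from the left, and are dual for the A_e-valued
    pairing (x, y) |-> pi(x y). *)
Definition frobenius_system (r : seq (G * A * A)) : Prop :=
  [/\ {in r, forall t, t.1.2 \in gA t.1.1^-1%g /\ t.2 \in gA t.1.1},
      forall x, x = \sum_(t <- r) vsval (pi_e (x * t.1.2)) * t.2 &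
      forall y, y = \sum_(t <- r) t.1.2 * vsval (pi_e (t.2 * y))].

(** The unit of the adjunction. *)
Definition coind_unit (N : lmodType Ae) (n : N) : coind N.
Proof.
exists (fun x => pi_e x *: n) => [x y|b x]; first by rewrite pi_eD scalerDl.
by rewrite pi_eMl scalerA.
Defined.

Fact coind_unit_in (N : lmodType Ae) (n : N) :
  (coind_unit n : grmod_coind N) \in hc _ 1%g.
Proof.
apply/coind_hcP => h; rewrite invg1 => h1 x xh /=.
by rewrite (pi_e_off h1 xh) scale0r.
Qed.

Definition coind_eta (N : lmodType Ae) (n : N) : hc_e (grmod_coind N) :=
  HcE (coind_unit_in n).

Fact coind_eta_linear (N : lmodType Ae) : linear (@coind_eta N).
Proof.
move=> b m n; apply: val_inj; apply: coind_eq => x.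
rewrite -[LHS]/(pi_e x *: (b *: m + n)).
rewrite -[RHS]/(pi_e (x * vsval b) *: m + pi_e x *: n).
by rewrite pi_eMr scalerDr scalerA.
Qed.
HB.instance Definition _ N := GRing.isLinear.Build Ae N (hc_e (grmod_coind N)) _
  (@coind_eta N) (@coind_eta_linear N).

Definition coind_restr (N : lmodType Ae) (M : grmod gA)
    (w : grhom (grmod_coind N) M) : {linear N -> hc_e M} :=
  hc_e_map w \o @coind_eta N.

Section CoindLeftAdjoint.
Variables (r : seq (G * A * A)) (Hr : frobenius_system r).

(** This is the identity sum a a_t (x) x_t = sum a_t (x) x_t a, pushed forward
    along v o f. Both sides expand to the double sum of
    a_s pi(x_s a a_t) (x) x_t: the left one by the second expansion of a a_t,
    the right one by the first expansion of x_s a, since scalars of A_e move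
    across the tensor sign. *)
Lemma casimir (N : lmodType Ae) (M : lmodType A) (v : N -> M)
    (f : coind N) (a : A) :
  {morph v : x y / x + y} -> (forall b x, v (b *: x) = vsval b *: v x) ->
  a *: \sum_(t <- r) t.1.2 *: v (f t.2) =
  \sum_(t <- r) t.1.2 *: v (f (t.2 * a)).
Proof.
move=> vD vZ; have [_ r1 r2] := Hr.
have v0 : v 0 = 0 by rewrite -(scale0r 0) vZ raddf0 scale0r.
rewrite scaler_sumr.
transitivity (\sum_(t <- r) \sum_(s <- r)
    (s.1.2 * vsval (pi_e (s.2 * (a * t.1.2)))) *: v (f t.2)).
  by apply: eq_bigr => t _; rewrite scalerA {1}(r2 (a * t.1.2)) scaler_suml.
rewrite exchange_big; apply: eq_bigr => s _.
rewrite [in RHS](r1 (s.2 * a)) coind_sum (big_morph v vD v0) scaler_sumr.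
by apply: eq_bigr => t _; rewrite coind_scale vZ scalerA mulrA.
Qed.

(** The map N -> M_e extends to coind N -> M by way of the Casimir element.
    It respects degrees because a map f of degree g kills every x_t except
    those of degree g^-1, whose partners a_t have degree g. *)
Section OfUnit.
Variables (N : lmodType Ae) (M : grmod gA) (v : {linear N -> hc_e M}).

Definition coind_ext_fun (f : coind N) : M :=
  \sum_(t <- r) t.1.2 *: val (v (f t.2)).

Fact coind_ext_linear : linear coind_ext_fun.
Proof.
move=> a f g; rewrite /coind_ext_fun.
rewrite (casimir (v := fun n => val (v n)) f a) => [|x y|b x].
- rewrite -big_split; apply: eq_bigr => t _.
  by rewrite [v _]raddfD; exact: scalerDr.
- by rewrite raddfD.
- by rewrite linearZ.
Qed.
HB.instance Definition _ := GRing.isLinear.Build A (coind N) M _ coind_ext_fun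
  coind_ext_linear.

Definition coind_ext : grhom (grmod_coind N) M.
Proof.
exists (coind_ext_fun : {linear coind N -> M}) => g f /coind_hcP fg.
have [rh _ _] := Hr; rewrite /= /coind_ext_fun big_seq.
have [M0 MB] := dsum_zmod (hc_dsum M) g.
have MD : {in hc M g &, forall x y, x + y \in hc M g}.
  by move=> x y xM yM; rewrite -[y]opprK MB // -sub0r MB.
apply: (big_ind (fun x => x \in hc M g)) => // t /rh[tg th].
have [e|/fg E] := eqVneq t.1.1 g^-1%g; last by rewrite (E _ th) !raddf0.
rewrite e invgK in tg.
by have := hc_scale tg (valP (v (f t.2))); rewrite mulg1.
Defined.
End OfUnit.

Lemma coind_left_adjoint : left_adjoint coind_functor (degree_e_functor gA).
Proof.
have [_ r1 r2] := Hr.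
exists coind_restr; split.
- move=> N M; exists (@coind_ext N M) => [w|v].
  + apply: grhom_eq => f /=; rewrite /coind_ext_fun /=.
    transitivity (sval w
      (\sum_(t <- r) t.1.2 *: (coind_unit (f t.2) : coind N))).
      by rewrite raddf_sum; apply: eq_bigr => t _; rewrite [RHS]linearZ.
    congr (sval w _).
    apply: coind_eq => x; rewrite coindEsum [in RHS](r1 x) coind_sum.
    by apply: eq_bigr => t _; rewrite coind_scale.
  + apply: linear_eq => n; apply: val_inj; rewrite /= /coind_ext_fun /=.
    rewrite -[RHS]scale1r [in RHS](r2 1) scaler_suml.
    by apply: eq_bigr => t _; rewrite linearZ /= -scalerA mulr1.
- move=> N N' M M' a b w; apply: linear_eq => n; apply: val_inj => /=.
  congr (sval b (sval w _)); apply: coind_eq => x /=.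
  by rewrite linearZ.
Qed.

End CoindLeftAdjoint.

(** * Frobenius systems from a graded isomorphism of A with its dual *)

Lemma k_scale_e (c : k) (x : A) : c *: x = vsval (c *: 1 : Ae) * x.
Proof.
by rewrite -[vsval _]/(c *: vsval (1 : Ae)) (gr_e_val1 gA) -scalerAl mul1r.
Qed.

Lemma alg_dualD (mu : alg_dual A) x y : mu (x + y) = mu x + mu y.
Proof. exact: linearD. Qed.

(** A linear form supported in degree e such that a |-> lam(- a) is a bijection
    from A to A^*. *)
Definition frobenius_form (lam : alg_dual A) : Prop :=
  [/\ forall g x, g != 1%g -> x \in gA g -> lam x = 0,
      forall a, (forall x, lam (x * a) = 0) -> a = 0 &
      forall mu : alg_dual A, exists a, forall x, mu x = lam (x * a)].

Lemma grhom_ext (M M' : grmod gA) (f h : grhom M M') x :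
  f = h -> sval f x = sval h x.
Proof. by move=> ->. Qed.

(** The form is the image of 1: by A-linearity, f(a) = a f(1) = f(1)(- a). *)
Lemma graded_frobenius_form :
  graded_frobenius gA -> exists lam, frobenius_form lam.
Proof.
move=> [[f fgr] [[f' f'gr] [f'K fK]]].
have {}f'K a : f' (f a) = a by have := grhom_ext a f'K.
have {}fK mu : f (f' mu) = mu by have := grhom_ext mu fK.
have fE (a x : A) : (f a : alg_dual A) x = (f 1 : alg_dual A) (x * a).
  rewrite -dual_scaleE -[dual_scale _ _]/(a *: f 1) -linearZ.
  by congr ((f _ : alg_dual A) x); rewrite -[RHS]/(a * 1) mulr1.
exists (f 1); split.
- move=> g x g1 xg; have /asboolP := fgr 1%g 1 (gr_one gA).
  by move/(_ g); rewrite invg1; apply.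
- move=> a a0; rewrite -[a]f'K (_ : f a = 0) ?raddf0 //.
  by apply/lfunP => x; rewrite fE a0 zero_lfunE.
- by move=> mu; exists (f' mu) => x; rewrite -fE fK.
Qed.

Section Form.
Variables (lam : alg_dual A) (Hlam : frobenius_form lam).

Lemma form_pi_e x : lam (vsval (pi_e x)) = lam x.
Proof.
have [lam0 _ _] := Hlam.
elim/(direct_sum_ind (gr_dsum gA)): x => [|x y Hx Hy|g x xg].
- by rewrite !raddf0.
- rewrite pi_eD -[vsval _]/(vsval (pi_e x) + vsval (pi_e y)).
  by rewrite !alg_dualD Hx Hy.
have [g1|g1] := eqVneq g 1%g; last first.
  by rewrite (pi_e_off g1 xg) (lam0 g x g1 xg) !raddf0.
by subst g; rewrite val_pi_e component_id.
Qed.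

(** The form restricts to a Frobenius form of A_e: the other components of A
    pair trivially with A_e. *)
Lemma form_e_nondegenerate (c : Ae) :
  (forall b : Ae, lam (vsval (b * c)) = 0) -> c = 0.
Proof.
move=> c0; have [_ nd _] := Hlam; apply: gr_e_inj; rewrite raddf0.
by apply: nd => x; rewrite -form_pi_e pi_eMr.
Qed.

Lemma pi_e_nondegenerate y : (forall x, pi_e (x * y) = 0) -> y = 0.
Proof.
move=> y0; have [_ nd _] := Hlam; apply: nd => x.
by rewrite -form_pi_e y0 raddf0.
Qed.

(** Composing f with lam gives a linear form lam(- a); then f and pi(- a) have
    the same composite with lam, also after multiplication by any b in A_e, and
    nondegeneracy on A_e separates them. *)
Lemma pi_e_represents (f : coind (Ae^o : lmodType Ae)) :
  exists a, forall x, f x = pi_e (x * a).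
Proof.
have [_ _ repr] := Hlam.
have mu_lin : linear (fun x => lam (vsval (f x : Ae)) : k^o).
  move=> c x y; rewrite coind_add k_scale_e coind_scale.
  rewrite -[_ *: f x]/((c *: 1 : Ae) * (f x : Ae)) -scalerAl mul1r.
  exact: (linearP lam c (vsval (f x : Ae)) (vsval (f y : Ae))).
pose mu : {linear A -> k^o} := HB.pack (fun x => lam (vsval (f x : Ae)) : k^o)
  (GRing.isLinear.Build k A k^o _ _ mu_lin).
have [a Ha] := repr (linfun mu).
exists a => x; apply/eqP; rewrite -subr_eq0; apply/eqP.
apply: form_e_nondegenerate => b.
have := Ha (vsval b * x); rewrite lfunE /= coind_scale -mulrA.
rewrite -(form_pi_e (vsval b * (x * a))) pi_eMl => E.
transitivity (lam (vsval (b * (f x : Ae)) - vsval (b * pi_e (x * a)))).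
  by congr (lam _); exact: (congr1 vsval (mulrBr b (f x : Ae) (pi_e (x * a)))).
by rewrite linearB; apply/eqP; rewrite subr_eq0; apply/eqP.
Qed.
End Form.

(** A k-basis of A generates it over A_e; the dual basis consists of the
    coordinates of a section of the resulting map from a free module. *)
Lemma projective_dual_basis : projective (res_e gA (A^o : lmodType A)) ->
  exists n (x : 'I_n -> A) (f : 'I_n -> coind (Ae^o : lmodType Ae)),
    forall y, y = \sum_i vsval (f i y : Ae) * x i.
Proof.
move=> proj; pose n := \dim {:A}%VS; pose x (i : 'I_n) := (vbasis {:A}%VS)`_i.
pose p0 (v : 'rV[Ae]_n) : res_e gA (A^o : lmodType A) :=
  \sum_i vsval (v 0 i) * x i.
have p_lin : linear p0.
  move=> b u v; rewrite /p0 scaler_sumr -big_split; apply: eq_bigr => i _.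
  by rewrite !mxE raddfD /= mulrDl -mulrA.
pose p : {linear 'rV[Ae]_n -> res_e gA (A^o : lmodType A)} :=
  HB.pack p0 (GRing.isLinear.Build Ae _ _ _ p0 p_lin).
have psurj y : exists v, p v = y.
  exists (\row_i (coord (vbasis {:A}%VS) i y *: 1)).
  rewrite [RHS](coord_vbasis (memvf y)); apply: eq_bigr => i _.
  by rewrite mxE -k_scale_e.
have [s sK] := proj _ _ p (mod_id _) psurj.
have fD i : {morph (fun y : A => s y 0 i : Ae^o) : y z / y + z}.
  by move=> y z; rewrite raddfD mxE.
have fZ i (b : Ae) (y : A) : s (vsval b * y) 0 i = b * s y 0 i.
  by rewrite [s _]linearZ mxE.
exists n, x, (fun i => Coind (fD i) (fZ i)) => y.
by rewrite -[LHS]sK.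
Qed.

(** From the dual basis (x_i, pi(- a_i)), the homogeneous system consists of the
    components of x_i of degree h and of a_i of degree h^-1. For y of degree l,
    the terms with h <> l vanish because pi does outside degree e, and those
    with h = l add up to the component of degree l of
    sum_i pi(y a_i) x_i = y. *)
Lemma frobenius_system_exists :
  graded_frobenius gA -> projective (res_e gA (A^o : lmodType A)) ->
  exists r, frobenius_system r.
Proof.
move=> /graded_frobenius_form[lam Hlam] /projective_dual_basis[n [x [f fE]]].
have /choice[a Ha] i := pi_e_represents Hlam (f i).
have [s [_ ssum]] := component_sum.
pose c := component (gr_dsum gA).
pose r := [seq (h, c h^-1%g (a i), c h (x i)) | h <- s, i <- enum 'I_n].
have r1 y : y = \sum_(t <- r) vsval (pi_e (y * t.1.2)) * t.2.
  elim/(direct_sum_ind (gr_dsum gA)): y => [|y z Hy Hz|l y yl].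
  - by rewrite big1 // => t _; rewrite mul0r !raddf0 mul0r.
  - rewrite [LHS](congr2 +%R Hy Hz) -big_split; apply: eq_bigr => t _.
    by rewrite mulrDl pi_eD; exact: (esym (mulrDl _ _ _)).
  rewrite /r big_allpairs_dep {1}(ssum y); apply: eq_bigr => h _.
  rewrite big_enum.
  rewrite -[RHS]/(\sum_(i < n) vsval (pi_e (y * c h^-1%g (a i))) * c h (x i)).
  have [->{h}|hl] := eqVneq h l; last first.
    rewrite (component_off (gr_dsum gA) hl yl) big1 // => i _.
    rewrite (pi_e_off _ (gr_mul yl (component_in (gr_dsum gA) h^-1%g (a i)))).
      by rewrite mul0r.
    by apply: contra hl => /eqP e; rewrite -[h]mul1g -e mulgVK.
  rewrite {1}(fE y) component_big; apply: eq_bigr => i _.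
  have := component_mul l (x i) (gr_e_in (f i y)); rewrite mul1g => ->.
  congr (vsval _ * _); rewrite Ha; apply: gr_e_inj; rewrite !val_pi_e.
  rewrite -(mulgV l) !component_mul //; congr (y * _); apply: esym.
  exact: component_id (component_in _ _ _).
exists r; split => //.
- by move=> t /allpairsP[[h i] [_ _ ->]] /=; split; exact: component_in.
(* The two sides of the second identity have the same image under pi(z -) for
   every z: expand z by the first identity. *)
- move=> y; apply/eqP; rewrite -subr_eq0; apply/eqP.
  apply: (pi_e_nondegenerate Hlam) => z; rewrite mulrBr pi_eB.
  apply/eqP; rewrite subr_eq0; apply/eqP.
  rewrite {1}(r1 z) mulr_suml mulr_sumr !pi_e_sum; apply: eq_bigr => t _.
  by rewrite -mulrA pi_eMl mulrA pi_eMr.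
Qed.

(** * The dual of A is coinduced from the dual of A_e *)

Definition dual_pairing (f : alg_dual A) (x : A) : alg_dual Ae :=
  ((f : 'Hom(A, k^o)) \o amulr x \o linfun (vsval : Ae -> A))%VF.

Lemma dual_pairingE f x b : dual_pairing f x b = f (vsval b * x).
Proof. by rewrite /dual_pairing !comp_lfunE !lfunE. Qed.

Definition dual_to_coind (f : alg_dual A) : coind (alg_dual Ae : lmodType Ae).
Proof.
exists (dual_pairing f) => [x y|c x]; apply/lfunP => b.
  by rewrite add_lfunE !dual_pairingE mulrDr alg_dualD.
rewrite -[_ *: _]/(dual_scale c (dual_pairing f x)) dual_scaleE.
by rewrite !dual_pairingE gr_e_valM mulrA.
Defined.

Fact dual_to_coind_linear : linear dual_to_coind.
Proof.
move=> a f h; apply: coind_eq => x; apply/lfunP => b.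
rewrite coindED coindEZ add_lfunE !dual_pairingE add_lfunE.
by rewrite -[a *: f]/(dual_scale a f) dual_scaleE mulrA.
Qed.
HB.instance Definition _ := GRing.isLinear.Build A (alg_dual A)
  (coind (alg_dual Ae : lmodType Ae)) _ dual_to_coind dual_to_coind_linear.

Definition coind_to_dual_fun (f : coind (alg_dual Ae : lmodType Ae)) (x : A) :
  k^o := (f x : alg_dual Ae) 1.

Fact coind_to_dual_k_linear f : linear (coind_to_dual_fun f).
Proof.
move=> c x y; rewrite /coind_to_dual_fun coind_add add_lfunE k_scale_e.
rewrite coind_scale -[_ *: f x]/(dual_scale (c *: 1) (f x)) dual_scaleE mul1r.
by rewrite [(f x : alg_dual Ae) _]linearZ.
Qed.
HB.instance Definition _ f := GRing.isLinear.Build k A k^o _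
  (coind_to_dual_fun f) (coind_to_dual_k_linear f).

Definition coind_to_dual (f : coind (alg_dual Ae : lmodType Ae)) : alg_dual A :=
  linfun (coind_to_dual_fun f).

Lemma coind_to_dualE f x : coind_to_dual f x = (f x : alg_dual Ae) 1.
Proof. by rewrite lfunE. Qed.

Fact coind_to_dual_linear : linear coind_to_dual.
Proof.
move=> a f h; apply/lfunP => x; rewrite add_lfunE.
rewrite -[a *: coind_to_dual f]/(dual_scale a (coind_to_dual f)) dual_scaleE.
by rewrite !coind_to_dualE coindED coindEZ add_lfunE.
Qed.
HB.instance Definition _ := GRing.isLinear.Build A
  (coind (alg_dual Ae : lmodType Ae)) (alg_dual A) _ coind_to_dual
  coind_to_dual_linear.

(** A linear form f corresponds to x |-> f(- x) restricted to A_e, and is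
    recovered by evaluating at 1. *)
Lemma dual_coind_isomorphic : isomorphic (C := grmod_cat gA)
  (grmod_dual gA) (grmod_coind (alg_dual Ae : lmodType Ae)).
Proof.
have fgr g (f : grmod_dual gA) : f \in hc _ g ->
    (dual_to_coind f : grmod_coind _) \in hc _ g.
  move=> /asboolP fg; apply/coind_hcP => h hg x xh; apply/lfunP => b.
  rewrite dual_pairingE zero_lfunE (fg h) //.
  by have := gr_mul (gr_e_in b) xh; rewrite mul1g.
have hgr g (f : grmod_coind (alg_dual Ae : lmodType Ae)) : f \in hc _ g ->
    (coind_to_dual f : grmod_dual gA) \in hc _ g.
  move=> /coind_hcP fg; apply/asboolP => h hg x xh.
  by rewrite coind_to_dualE (fg h) // zero_lfunE.
exists (exist _ (dual_to_coind : {linear _ -> _}) fgr).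
exists (exist _ (coind_to_dual : {linear _ -> _}) hgr).
split; apply: grhom_eq => f /=.
- by apply/lfunP => x; rewrite coind_to_dualE dual_pairingE gr_e_val1 mul1r.
- apply: coind_eq => x; apply/lfunP => b.
  rewrite dual_pairingE coind_to_dualE coind_scale.
  by rewrite -[_ *: _]/(dual_scale b (f x)) dual_scaleE mul1r.
Qed.

(** * A left adjoint of the component functor sends A_e to A *)

Section EvalRegular.
Variables (M : grmod gA).

Definition regular_restr_fun (u : grhom (grmod_regular gA) M) (b : Ae^o) :
  hc_e M := hc_e_map u (@HcE _ _ _ _ (grmod_regular gA) _ (gr_e_in b)).

Fact regular_restr_linear u : linear (regular_restr_fun u).
Proof. by move=> c x y; apply: val_inj; exact: linearP. Qed.
HB.instance Definition _ u := GRing.isLinear.Build Ae Ae^o (hc_e M) _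
  (regular_restr_fun u) (regular_restr_linear u).

Definition regular_restr u : {linear Ae^o -> hc_e M} := regular_restr_fun u.

Definition regular_ext_fun (m : hc_e M) (a : A^o) : M := a *: val m.

Fact regular_ext_linear m : linear (regular_ext_fun m).
Proof.
by move=> c x y; rewrite /regular_ext_fun scalerDl -[c *: x]/(c * x) scalerA.
Qed.
HB.instance Definition _ m := GRing.isLinear.Build A A^o M _
  (regular_ext_fun m) (regular_ext_linear m).

Definition regular_ext (m : hc_e M) : grhom (grmod_regular gA) M.
Proof.
exists (regular_ext_fun m : {linear A^o -> M}) => g x xg.
by have := hc_scale xg (valP m); rewrite mulg1.
Defined.
End EvalRegular.

(** Both A and H(A_e) corepresent M |-> M_e: a graded map from A to M is
    determined by the image of 1, an arbitrary element of M_e. *)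
Lemma regular_left_adjoint (H : functor (mod_cat Ae) (grmod_cat gA)) :
  left_adjoint H (degree_e_functor gA) ->
  isomorphic (C := grmod_cat gA) (grmod_regular gA) (H (Ae^o : lmodType Ae)).
Proof.
move=> adj; refine (@left_adjoint_corepresents (grmod_cat gA) (mod_cat Ae)
  (degree_e_functor gA) H (Ae^o : lmodType Ae) (grmod_regular gA) regular_restr
  adj _ _).
- move=> M; exists (fun v : {linear Ae^o -> hc_e M} => regular_ext (v 1)).
  + move=> u; apply: grhom_eq => a.
    rewrite /= /regular_ext_fun /= -linearZ; congr (sval u _).
    exact: etrans (congr1 (GRing.mul a) (gr_e_val1 gA)) (mulr1 a).
  + move=> v; apply: linear_eq => b; apply: val_inj.
    rewrite -[LHS]/(val (b *: v 1)) -linearZ; congr (val (v _)).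
    exact: mulr1.
- by move=> M M' b u; apply: linear_eq => x; apply: val_inj.
Qed.

End Graded.

(** * The theorem *)

Theorem theorem7p4 (k : fieldType) (G : groupType) (A : falgType k)
    (gA : grading G A) :
  (graded_frobenius gA -> projective (res_e gA (A^o : lmodType A)) ->
     frobenius_functor (degree_e_functor gA))
  /\
  (frobenius_functor (degree_e_functor gA) -> frobenius_algebra (gr_e gA) ->
     graded_frobenius gA).
Proof.
split=> [gf proj|[H [HR HL]] fr].
  have [r Hr] := frobenius_system_exists gf proj.
  exists (coind_functor gA); split; first exact: coind_right_adjoint.
  exact: coind_left_adjoint Hr.
apply: isomorphic_trans (regular_left_adjoint HL) _.
apply: isomorphic_trans
  (right_adjoint_unique _ HR (coind_right_adjoint gA)) _.
apply: isomorphic_trans (isomorphic_fmap (coind_functor gA) fr) _.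
exact: isomorphic_sym (dual_coind_isomorphic gA).
Qed.
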